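(* Let $A$ be a nonempty finite subset of an abelian group $(G,+)$ and let $h\ge 2$ be an integer. Then $$|(h-1)A|\ge \theta(x,h)\,|hA|^{(h-1)/h},$$ where $x\in\mathbb{R}$ satisfies $x\ge h$ and $|hA|=\binom{x}{h}$.
   Context: For an integer $h\ge 1$, $hA=\{x_1+\dots+x_h \mid x_1,\dots,x_h\in A\}$ denotes the $h$-fold iterated sumset of $A$. For $m\in\mathbb{N}$ and $x\in\mathbb{R}$, $\binom{x}{m}=\frac{x(x-1)\cdots(x-m+1)}{m!}$. For every integer $h\ge1$ and positive integer $d$ there is a unique real number $x\ge h$ with $\binom{x}{h}=d$. For a positive integer $h$ and a real number $x\ge h$, $$\theta(x,h)=\frac{h}{x}\binom{x}{h}^{1/h}.$$ *)

(* Defs.v *)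
From HB Require Import structures.
From mathcomp Require Import all_boot all_order all_algebra.
From mathcomp Require Import finmap.
From mathcomp Require Import reals exp.

Set Implicit Arguments.
Unset Strict Implicit.
Unset Printing Implicit Defensive.

Import Order.TTheory GRing.Theory Num.Theory.

Local Open Scope ring_scope.
Local Open Scope fset_scope.

(* [{ffun 'I_h -> A}] ranges over the h-tuples (x_1, ..., x_h) of elements
   of the finite set [A], repetitions allowed. *)
Definition sumset (G : zmodType) (h : nat) (A : {fset G}) : {fset G} :=
  [fset \sum_(i < h) val (f i) | f : {ffun 'I_h -> A} in {: {ffun 'I_h -> A}}].

Definition gbinom (R : realType) (x : R) (m : nat) : R :=
  (\prod_(i < m) (x - i%:R)) / (m`!)%:R.

Definition theta (R : realType) (x : R) (h : nat) : R :=
  h%:R / x * (gbinom x h) `^ (1 / h%:R).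

(* Main.v *)
(* Since gbinom x h = x / h * gbinom (x - 1) (h - 1), the claim reads
   |(h-1)A| >= gbinom (x - 1) (h - 1). Choose for every element of dA, d <= h,
   its representation v_1 a_1 + ... + v_n a_n, v_1 + ... + v_n = d, of least
   weight, for an injective additive weight on exponent vectors. Lowering an
   entry of a minimal representation leaves it minimal, so the shadow of the
   representations of hA lies among those of (h-1)A, and it suffices to prove a
   real-variable form of Macaulay's theorem for arbitrary sets of monomials.
   This goes by induction on the number of variables and the degree, splitting
   off one variable; the induction step rests on the concavity of the maps
   gbinom t m |-> gbinom (t - 1) (m - 1), a consequence of the convexity of
   1 / gbinom s (m - 1), a product of positive decreasing convex factors. *)

Require Import Defs.
From HB Require Import structures.
From mathcomp Require Import all_boot all_order all_algebra.
From mathcomp Require Import finmap.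
From mathcomp Require Import reals exp.
From mathcomp Require Import ring lra zify.

Set Implicit Arguments.
Unset Strict Implicit.
Unset Printing Implicit Defensive.

Import Order.TTheory GRing.Theory Num.Theory.

Local Open Scope ring_scope.

(** * Real binomial coefficients: recurrences, monotonicity, convexity, range *)

Section RealBinomial.
Variable R : realType.
Implicit Types (s t x y z : R) (m : nat).

Lemma gbinom0 x : gbinom x 0 = 1.
Proof. by rewrite /gbinom big_ord0 fact0 divr1. Qed.

Lemma gbinomS x m : gbinom x m.+1 = gbinom x m * (x - m%:R) / m.+1%:R.
Proof.
rewrite /gbinom big_ord_recr /= factS natrM.
by field; rewrite addrC natr1 pnatr_eq0 /= pnatr_eq0 -lt0n fact_gt0.
Qed.

Lemma gbinomS_shift x m : gbinom x m.+1 = x / m.+1%:R * gbinom (x - 1) m.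
Proof.
rewrite /gbinom big_ord_recl /= subr0 factS natrM.
under eq_bigr => i _ do rewrite /bump /= natrD opprD addrA.
by field; rewrite addrC natr1 pnatr_eq0 /= pnatr_eq0 -lt0n fact_gt0.
Qed.

Lemma gbinom_pascal x m :
  gbinom x m.+1 = gbinom (x - 1) m.+1 + gbinom (x - 1) m.
Proof.
rewrite gbinomS_shift gbinomS; field.
by rewrite addrC natr1 pnatr_eq0.
Qed.

Lemma gbinom_ge0 x m : m%:R - 1 <= x -> 0 <= gbinom x m.
Proof.
elim: m => [|m IHm] hx; first by rewrite gbinom0.
rewrite gbinomS divr_ge0 ?ler0n// mulr_ge0 ?IHm//; move: hx; rewrite -natr1; lra.
Qed.

Lemma gbinom_gt0 x m : m%:R - 1 < x -> 0 < gbinom x m.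
Proof.
elim: m => [|m IHm] hx; first by rewrite gbinom0.
rewrite gbinomS divr_gt0 ?ltr0n// mulr_gt0 ?IHm//; move: hx; rewrite -natr1; lra.
Qed.

Lemma gbinom_le s t m : m%:R - 1 <= s -> s <= t -> gbinom s m <= gbinom t m.
Proof.
elim: m => [|m IHm] hs hst; first by rewrite !gbinom0.
rewrite -natr1 in hs.
rewrite !gbinomS ler_pM2r ?invr_gt0 ?ltr0n// ler_pM ?gbinom_ge0 ?IHm//; lra.
Qed.

Lemma gbinom_le_inv s t m : m%:R <= t ->
  gbinom s m.+1 < gbinom t m.+1 -> s < t.
Proof.
move=> mt; case: (ltP s t) => // ts; rewrite ltNge gbinom_le// -natr1; lra.
Qed.

Lemma gbinom_nat_root m : gbinom (m%:R : R) m.+1 = 0.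
Proof. by rewrite gbinomS subrr mulr0 mul0r. Qed.

(* Convexity of the function s |-> (gbinom s m)^-1, with denominators cleared. *)
Lemma gbinom_inv_convex s1 s2 s3 m (p := fun s => gbinom s m) :
    m%:R - 1 <= s1 -> s1 <= s2 -> s2 <= s3 ->
  p s1 * p s3 * (s3 - s1) <= p s2 * p s3 * (s3 - s2) + p s1 * p s2 * (s2 - s1).
Proof.
rewrite {}/p; elim: m => [|m IHm] h1 h12 h23.
  by rewrite !gbinom0 !mul1r; lra.
rewrite -natr1 in h1.
have p1ge0 : 0 <= gbinom s1 m by apply: gbinom_ge0; lra.
have p2ge0 : 0 <= gbinom s2 m by apply: gbinom_ge0; lra.
have p23 : gbinom s2 m <= gbinom s3 m by apply: gbinom_le; lra.
have {IHm} := IHm _ h12 h23.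
rewrite !gbinomS; set d := m.+1%:R^-1.
have d0 : 0 < d by rewrite invr_gt0 ltr0n.
move: (gbinom s1 m) (gbinom s2 m) (gbinom s3 m) p1ge0 p2ge0 p23.
move=> p1 p2 p3 p1ge0 p2ge0 p23 IH.
(* The induction hypothesis times the new factors at [s2] and [s3]. Putting [s1 - m] where it
   belongs changes this by exactly the term of [H2], nonnegative because the next binomial grows
   from [s2] to [s3]. *)
have H : 0 <= (s2 - m%:R) * (s3 - m%:R) *
    (p2 * p3 * (s3 - s2) + p1 * p2 * (s2 - s1) - p1 * p3 * (s3 - s1)).
  by rewrite !mulr_ge0// ?subr_ge0; [lra|lra|apply: IH; lra].
have H2 : 0 <= p1 * (s2 - s1) * (s3 - s1) * (p3 * (s3 - m%:R) - p2 * (s2 - m%:R)).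
  rewrite !mulr_ge0 ?subr_ge0 ?ler_pM//; lra.
have H3 : 0 <= d ^+ 2 by rewrite exprn_ge0 ?ltW.
rewrite -subr_ge0; have := mulr_ge0 H3 (addr_ge0 H H2).
congr (_ <= _); ring.
Qed.

(* Concavity of the function sending [gbinom t m.+1] to [gbinom (t - 1) m],
   as a comparison of the slopes of two consecutive chords. *)
Lemma gbinom_chord t1 t2 t3 m (p := fun t => gbinom (t - 1) m)
    (d := fun t => gbinom t m.+1) :
    m%:R <= t1 -> t1 <= t2 -> t2 <= t3 ->
  (p t3 - p t2) * (d t2 - d t1) <= (p t2 - p t1) * (d t3 - d t2).
Proof.
rewrite {}/p {}/d => h1 h12 h23.
have p1ge0 : 0 <= gbinom (t1 - 1) m by apply: gbinom_ge0; lra.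
have p12 : gbinom (t1 - 1) m <= gbinom (t2 - 1) m by apply: gbinom_le; lra.
have p23 : gbinom (t2 - 1) m <= gbinom (t3 - 1) m by apply: gbinom_le; lra.
(* As [d t = c * t * p t] with [c = 1 / m.+1], the cross-multiplied slope inequality is [c] times
   this convexity inequality. *)
have := @gbinom_inv_convex (t1 - 1) (t2 - 1) (t3 - 1) m.
rewrite !lerD2r !gbinomS_shift => /(_ h1 h12 h23).
have c0 : 0 < m.+1%:R^-1 :> R by rewrite invr_gt0 ltr0n.
move: (gbinom _ _) (gbinom _ _) (gbinom _ _) (m.+1%:R^-1) p1ge0 p12 p23 c0.
move=> p1 p2 p3 c p1ge0 p12 p23 c0 H.
rewrite -subr_ge0 in H; rewrite -subr_ge0.
have := mulr_ge0 (ltW c0) H; congr (_ <= _); ring.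
Qed.

(** Put [b = gbinom (x - 1) j.+1], [f = gbinom y j.+1] and [c = gbinom (x - 2) j]. Concavity on
    [[x - 1, x]] with Pascal's rule gives [gbinom (z - 1) j.+1 >= b - c * f / b]; concavity on
    [[j, x - 1]], starting at the root [j], gives [gbinom (y - 1) j >= c * f / b]. The two errors
    cancel. *)
Lemma gbinom_split_shadow x y z j :
    j.+2%:R <= x -> x - 1 <= z -> z <= x -> j%:R <= y -> y <= x - 1 ->
    gbinom z j.+2 + gbinom y j.+1 = gbinom x j.+2 ->
  gbinom (x - 1) j.+1 <= gbinom (z - 1) j.+1 + gbinom (y - 1) j.
Proof.
rewrite -!natr1 => hx hz1 hz2 hy1 hy2 Hsum.
have b0 : 0 < gbinom (x - 1) j.+1 by apply: gbinom_gt0; rewrite -natr1; lra.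
have f1ge0 : 0 <= gbinom y j.+1 by apply: gbinom_ge0; rewrite -natr1; lra.
have fb : gbinom y j.+1 <= gbinom (x - 1) j.+1.
  by apply: gbinom_le; rewrite -?natr1; lra.
have e0 : 0 <= gbinom (j%:R - 1 : R) j by exact: gbinom_ge0.
have /= := @gbinom_chord (x - 1) z x j.+1 _ hz1 hz2.
rewrite -natr1 => /(_ ltac:(lra)) C1.
have /= := @gbinom_chord j%:R y (x - 1) j (lexx _) hy1 hy2.
rewrite gbinom_nat_root => C2.
have P1 := gbinom_pascal x j.+1; have P2 := gbinom_pascal (x - 1) j.
rewrite -(ler_pM2l b0); move: Hsum P1 C1 => /(canRL (addrK _)) -> -> C1.
have E := mulr_ge0 e0 (etrans (subr_ge0 _ _) fb).
move: P2 C1 C2 E; move: (gbinom _ _) (gbinom _ _) (gbinom _ _).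
move=> c a b -> C1 C2 E; lra.
Qed.

(** Intermediate value theorem for a polynomial: the binomial is 1 at [m.+1] and at least [c] at
    [m + c]. *)
Lemma gbinom_surj (c : R) m : 1 <= c -> exists2 z, m.+1%:R <= z & gbinom z m.+1 = c.
Proof.
move=> c1.
pose p : {poly R} := \prod_(i < m.+1) ('X - (i%:R)%:P).
have pE t : p.[t] = gbinom t m.+1 * (m.+1)`!%:R.
  rewrite /p horner_prod /gbinom divfK ?pnatr_eq0 -?lt0n ?fact_gt0//.
  by apply: eq_bigr => i _; rewrite !hornerE.
have big : c <= gbinom (m%:R + c) m.+1.
  elim: m {p pE} => [|m IHm].
    by rewrite gbinomS gbinom0 !mulr0n subr0 divr1 mul1r add0r.
  rewrite gbinomS_shift -{2}natr1 addrAC addrK -[c in c <= _]mul1r.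
  rewrite ler_pM//; first lra.
  by rewrite ler_pdivlMr ?ltr0n// mul1r -[m.+2%:R]natr1 lerD2l.
have one : gbinom (m.+1%:R : R) m.+1 = 1.
  elim: m {p pE big} => [|m IHm].
    by rewrite gbinomS gbinom0 !mulr0n subr0 divr1 mul1r.
  rewrite gbinomS_shift divff ?pnatr_eq0// mul1r.
  by rewrite -[m.+2%:R]natr1 addrK.
have f0 : 0 < (m.+1)`!%:R :> R by rewrite ltr0n fact_gt0.
have le : m.+1%:R <= m%:R + c by rewrite -natr1; lra.
have [|z /andP[z1 _]] := @poly_ivt R (p - (c * (m.+1)`!%:R)%:P) _ _ le.
  by rewrite !hornerE !pE one subr_le0 subr_ge0 !ler_pM2r// c1 big.
rewrite /root hornerD hornerN hornerC pE -mulrBl.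
rewrite mulf_eq0 (gt_eqF f0) orbF subr_eq0 => /eqP zc.
by exists z.
Qed.

End RealBinomial.

(** * Exponent vectors, splitting off the first variable, and the shadow bound *)

Lemma incr_nth_sumn_gt0 v : (0 < sumn v)%N ->
  exists u i, (i < size u)%N /\ v = incr_nth u i.
Proof.
elim: v => // -[|e] v IHv /= v0; last by exists (e :: v), 0.
by have [u [i [iu ->]]] := IHv v0; exists (0 :: u)%N, i.+1.
Qed.

Lemma sumn_incr_nth v i : (i < size v)%N -> sumn (incr_nth v i) = (sumn v).+1.
Proof. by elim: v i => // e v IHv [|i] //= /IHv ->; rewrite addnS. Qed.

(** The defaults, [1] here and [0] in [head_pos], keep the empty vector out of both halves. *)
Definition head_zero (F : seq (seq nat)) :=
  [seq behead v | v <- F & head 1%N v == 0%N].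

Definition head_pos (F : seq (seq nat)) :=
  [seq (head 0%N v).-1 :: behead v | v <- F & head 0%N v != 0%N].

Lemma mem_head_zero F v : (v \in head_zero F) = (0%N :: v \in F).
Proof.
apply/mapP/idP => [[[|e w]]|Fv]; rewrite ?mem_filter ?andbF//=.
  by move=> /andP[/eqP-> ?] ->.
by exists (0%N :: v); rewrite ?mem_filter.
Qed.

Lemma mem_head_pos F e v : (e :: v \in head_pos F) = (e.+1 :: v \in F).
Proof.
apply/mapP/idP => [[[|[|f] w]]|Fv]; rewrite ?mem_filter ?andbF//=.
  by move=> Fw [-> ->].
by exists (e.+1 :: v); rewrite ?mem_filter.
Qed.

Lemma uniq_head_zero F : uniq F -> uniq (head_zero F).
Proof.
move=> uF; rewrite map_inj_in_uniq ?filter_uniq// => -[|e v] [|f w];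
  rewrite !mem_filter ?andbF//= => /andP[/eqP-> _] /andP[/eqP-> _] -> //.
Qed.

Lemma uniq_head_pos F : uniq F -> uniq (head_pos F).
Proof.
move=> uF; rewrite map_inj_in_uniq ?filter_uniq// => -[|[|e] v] [|[|f] w];
  by rewrite !mem_filter ?andbF//= => _ _ [-> ->].
Qed.

Lemma size_head_split F :
  (size (head_zero F) + size (head_pos F) + count_mem [::] F = size F)%N.
Proof.
rewrite !size_map !size_filter; elim: F => //= -[|[|e] v] F IHF /=; lia.
Qed.

(* With F0 and F1 the exponent vectors of F whose first entry is zero, resp.
   positive (and then lowered by one), the shadow of F contains F1 and also
   splits into the shadows of F0 and F1, so its size is at least
   max(|F1|, |shadow F0| + |shadow F1|). *)
Lemma shadow_bound (R : realType) n h (F S : seq (seq nat)) (x : R) :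
    uniq F -> uniq S ->
    (forall v, v \in F -> size v = n /\ sumn v = h.+1) ->
    (forall u i, (i < size u)%N -> incr_nth u i \in F -> u \in S) ->
    h.+1%:R <= x -> (size F)%:R = gbinom x h.+1 ->
  gbinom (x - 1) h <= (size S)%:R.
Proof.
elim: n h F S x => [|n IHn] h F S x.
  move=> _ _ degF _ hx cardF.
  have : 0 < (size F)%:R :> R by rewrite cardF gbinom_gt0//; lra.
  rewrite ltr0n; case: F degF {cardF} => // v F.
  by move=> /(_ v (mem_head _ _))[/size0nil->].
elim: h F S x => [|h IHh] F S x uF uS degF closS hx cardF.
  have : 0 < (size F)%:R :> R by rewrite cardF gbinom_gt0//; lra.
  rewrite gbinom0 ltr0n ler1n; case: F degF closS {uF cardF} => // v F degF closS _.
  have [_ sv] := degF v (mem_head _ _).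
  have [u [i [iu vE]]] : exists u i, (i < size u)%N /\ v = incr_nth u i.
    by apply: incr_nth_sumn_gt0; rewrite sv.
  have : u \in S by apply: (closS u i); rewrite // -vE mem_head.
  by case: S {uS closS}.
have F10 : size F = (size (head_zero F) + size (head_pos F))%N.
  rewrite -[LHS]size_head_split (count_memPn _) ?addn0//.
  by apply/negP => /degF[].
have S10 : (size (head_zero S) + size (head_pos S) <= size S)%N.
  by rewrite -[leqRHS]size_head_split leq_addr.
have F1S : (size (head_pos F) <= size S)%N.
  apply: uniq_leq_size; first exact: uniq_head_pos.
  move=> [/mapP[?]//|e v]; rewrite mem_head_pos => Fv.
  exact: (closS (e :: v) 0%N).
have shadow0 (z : R) : h.+2%:R <= z -> (size (head_zero F))%:R = gbinom z h.+2 ->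
    gbinom (z - 1) h.+1 <= (size (head_zero S))%:R.
  apply: (IHn h.+1 _ _ z (uniq_head_zero uF) (uniq_head_zero uS)) => [v|u i iu];
    rewrite !mem_head_zero.
    by move=> /degF[[->] <-].
  by move=> Fu; apply: (closS (0%N :: u) i.+1).
have shadow1 (y : R) : h.+1%:R <= y -> (size (head_pos F))%:R = gbinom y h.+1 ->
    gbinom (y - 1) h <= (size (head_pos S))%:R.
  apply: (IHh _ _ y (uniq_head_pos uF) (uniq_head_pos uS)).
  - move=> [/mapP[?]//|e v]; rewrite mem_head_pos.
    by move=> /degF[<- [<-]].
  - move=> [//|e u] i iu.
    case: i iu => [_|i iu]; rewrite /= !mem_head_pos => Fu.
      exact: (closS (e.+1 :: u) 0%N).
    exact: (closS (e.+1 :: u) i.+1).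
(* A large [F1] suffices alone, since it embeds in [S]. An empty [F1] leaves the bound for [F0] with
   the same [x]. Otherwise both parts are nonempty and have real parameters [z] and [y]. *)
have [f1_big|f1_small] := leP (gbinom (x - 1) h.+1) (size (head_pos F))%:R.
  by rewrite (le_trans f1_big)// ler_nat.
have [f1_0|f1_gt0] := posnP (size (head_pos F)).
  apply: (le_trans (shadow0 x hx _)).
    by rewrite -cardF F10 f1_0 addn0.
  by rewrite ler_nat (leq_trans _ S10) ?leq_addr.
rewrite F10 natrD in cardF.
have pasc := gbinom_pascal x h.+1.
have f1_ge1 : 1 <= (size (head_pos F))%:R :> R by rewrite ler1n.
have hxn := hx; rewrite -!natr1 in hxn.
have bge0 : 0 <= gbinom (x - 1) h.+2.
  by apply: gbinom_ge0; rewrite -!natr1; lra.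
have f0_ge1 : 1 <= (size (head_zero F))%:R :> R.
  by rewrite ler1n -(ltr0n R); lra.
have [z hz zE] := gbinom_surj h.+1 f0_ge1.
have [y hy yE] := gbinom_surj h f1_ge1.
have hzn := hz; have hyn := hy; rewrite -!natr1 in hzn hyn.
(* [F1] is nonempty, so [z < x]; it is smaller than [gbinom (x - 1) h.+1], so [y < x - 1] and, by
   Pascal's rule, [x - 1 < z]. *)
have zx : z < x by apply: (@gbinom_le_inv _ _ _ h.+1); rewrite -?natr1; lra.
have xz : x - 1 < z by apply: (@gbinom_le_inv _ _ _ h.+1); rewrite -?natr1; lra.
have yx : y < x - 1 by apply: (@gbinom_le_inv _ _ _ h); lra.
apply: (@le_trans _ _ (gbinom (z - 1) h.+1 + gbinom (y - 1) h)).
  by apply: gbinom_split_shadow; rewrite ?zE ?yE//; lra.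
apply: (@le_trans _ _ (size (head_zero S) + size (head_pos S))%:R).
  by rewrite natrD lerD ?shadow0 ?shadow1.
by rewrite ler_nat.
Qed.

(** * Weights, and exponent vectors of given length and degree *)

Fixpoint weight M (v : seq nat) : nat :=
  if v is e :: t then (e + M * weight M t)%N else 0%N.

Lemma weight_incr_nth M v i : (i < size v)%N ->
  weight M (incr_nth v i) = (weight M v + M ^ i)%N.
Proof.
elim: v i => // e v IHv [|i] /=; first by rewrite expn0 addn1.
by rewrite ltnS => /IHv ->; rewrite mulnDr addnA expnS.
Qed.

(** Each entry is at most the sum, hence below [M], so the weight reads a vector as base-[M] digits,
    lowest first. *)
Lemma weight_inj M u v : size u = size v -> (sumn u < M)%N -> (sumn v < M)%N ->
  weight M u = weight M v -> u = v.
Proof.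
elim: u v => [|e u IHu] [|f v] //= [suv] hu hv euv.
have eM : (e < M)%N by lia.
have fM : (f < M)%N by lia.
have ef : e = f.
  have := congr1 (modn^~ M) euv.
  by rewrite /= ![(_ + M * _)%N]addnC ![(M * _)%N]mulnC !modnMDl !modn_small.
rewrite ef; congr cons; apply: IHu; rewrite //; try lia.
move: euv; rewrite ef => /addnI /eqP; rewrite eqn_pmul2l; last lia.
by move=> /eqP.
Qed.

Fixpoint exponents (n d : nat) : seq (seq nat) :=
  if n is n'.+1
  then [seq e :: v | e <- iota 0 d.+1, v <- exponents n' (d - e)%N]
  else if d == 0%N then [:: [::]] else [::].

Lemma mem_exponents n d v :
  (v \in exponents n d) = (size v == n) && (sumn v == d).
Proof.
elim: n d v => [|n IHn] d v; first by case: d v => [|d] [|[|e] v].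
rewrite -[exponents _ _]/[seq e :: w | e <- iota 0 d.+1, w <- exponents n (d - e)%N].
apply/allpairsPdep/idP => [[e [w [+ +]]]|].
  rewrite mem_iota IHn => /= ed /andP[/eqP sw /eqP dw] ->.
  by rewrite /= sw dw eqxx subnKC//=; lia.
case: v => // e v /andP[/eqP[sv] /eqP dv]; exists e, v.
by rewrite mem_iota IHn sv eqxx -dv [sumn _]/= addKn eqxx; split=> //=; lia.
Qed.

(** * Representations of sumset elements of least weight *)

Section MinimalRepresentations.
Variables (G : zmodType) (A : {fset G}).
Let n := #|` A|.

Definition monomial_sum (v : seq nat) : G :=
  \sum_(i < n) (enum_fset A)`_i *+ nth 0%N v i.

Lemma monomial_sum_incr_nth v i : (i < n)%N ->
  monomial_sum (incr_nth v i) = monomial_sum v + (enum_fset A)`_i.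
Proof.
move=> ltin; rewrite /monomial_sum.
under eq_bigr => j _ do rewrite nth_incr_nth mulrnDr.
rewrite big_split /= addrC; congr (_ + _).
rewrite (bigD1 (Ordinal ltin)) //= eqxx big1 ?addr0// => j.
by rewrite -val_eqE /= eq_sym => /negPf->.
Qed.

Lemma mem_sumset0 g : (g \in sumset 0 A) = (g == 0).
Proof.
apply/imfsetP/eqP => [[f _ ->]|->]; first by rewrite big_ord0.
have f : {ffun 'I_0 -> A} by apply: finfun => -[].
by exists f; rewrite ?big_ord0.
Qed.

Lemma mem_sumsetS d g :
  reflect (exists2 a, a \in A & g - a \in sumset d A) (g \in sumset d.+1 A).
Proof.
apply: (iffP (imfsetP _ _ _ _)) => /= [[f _ ->]|[a aA /imfsetP[/= f _ fE]]].
  exists (val (f ord0)); first exact: valP.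
  rewrite big_ord_recl addrC addKr.
  apply/imfsetP; exists [ffun i => f (lift ord0 i)] => //=.
  by apply: eq_bigr => i _; rewrite ffunE.
exists [ffun i => if unlift ord0 i is Some j then f j else [` aA]%fset] => //=.
rewrite big_ord_recl ffunE unlift_none /=.
under eq_bigr => i _ do rewrite ffunE liftK.
by rewrite -fE addrC subrK.
Qed.

Lemma mem_sumset d g :
  reflect (exists2 v, v \in exponents n d & monomial_sum v = g)
          (g \in sumset d A).
Proof.
elim: d g => [|d IHd] g.
  rewrite mem_sumset0; apply: (iffP eqP) => [->|[v]].
    exists (nseq n 0%N).
      by rewrite mem_exponents size_nseq sumn_nseq mul0n !eqxx.
    by rewrite /monomial_sum big1// => i _; rewrite nth_nseq if_same mulr0n.
  rewrite mem_exponents => /andP[_ /eqP v0] <-.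
  rewrite /monomial_sum big1// => i _.
  suff -> : nth 0%N v i = 0%N by [].
  elim: v (i : nat) v0 => [|e v IHv] [|j] //=; first by case: e.
  by move=> /eqP; rewrite addn_eq0 => /andP[_ /eqP/IHv].
apply: (iffP (mem_sumsetS _ _)) => [[a aA /IHd[v]]|[v]]; rewrite !mem_exponents.
  move=> /andP[/eqP sv /eqP dv] vE; exists (incr_nth v (index a (enum_fset A))).
    rewrite mem_exponents size_incr_nth sv index_mem aA eqxx.
    by rewrite sumn_incr_nth ?sv ?index_mem// dv eqxx.
  by rewrite monomial_sum_incr_nth ?index_mem// vE nth_index// subrK.
move=> /andP[/eqP sv /eqP dv] <-.
have [|u [i [iu vE]]] := @incr_nth_sumn_gt0 v; first by rewrite dv.
move: sv dv; rewrite vE size_incr_nth iu sumn_incr_nth// => su [du].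
rewrite su in iu; exists (enum_fset A)`_i; first exact: mem_nth.
rewrite monomial_sum_incr_nth// addrK; apply/IHd; exists u => //.
by rewrite mem_exponents su du !eqxx.
Qed.

Definition minimal_exponents M d :=
  [seq v <- undup (exponents n d) |
    all (fun u => (monomial_sum u == monomial_sum v) ==>
                    (weight M v <= weight M u)%N)
        (exponents n d)].

Lemma mem_minimal_exponents M d v :
  reflect ((size v = n /\ sumn v = d) /\
           forall u, size u = n -> sumn u = d ->
             monomial_sum u = monomial_sum v -> (weight M v <= weight M u)%N)
          (v \in minimal_exponents M d).
Proof.
rewrite mem_filter mem_undup mem_exponents; apply: (iffP and3P).
  move=> [/allP minv /eqP sv /eqP dv]; split=> // u su du uv.
  by have := minv u; rewrite mem_exponents su du uv !eqxx => /(_ isT).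
move=> [[-> ->] minv]; split=> //; apply/allP => u.
by rewrite mem_exponents => /andP[/eqP su /eqP du]; apply/implyP => /eqP/minv->.
Qed.

(** Since [d < M] makes the weight injective in degree [d], each element has exactly one lightest
    representation. *)
Lemma size_minimal_exponents M d : (d < M)%N ->
  size (minimal_exponents M d) = #|` sumset d A|.
Proof.
move=> dM; rewrite -(size_map monomial_sum); apply: perm_size; apply: uniq_perm.
- rewrite map_inj_in_uniq ?filter_uniq ?undup_uniq//.
  move=> u v /mem_minimal_exponents[[su du] minu].
  move=> /mem_minimal_exponents[[sv dv] minv] uv.
  apply: (@weight_inj M); rewrite ?su ?sv ?du ?dv//.
  by apply/eqP; rewrite eqn_leq minu ?minv.
- exact: fset_uniq.
move=> g; apply/mapP/mem_sumset => [[v +]|[v Vv vE]].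
  by move=> /mem_minimal_exponents[[sv dv] _] ->; exists v; rewrite ?mem_exponents ?sv ?dv ?eqxx.
have exw : exists w,
    has (fun u => (monomial_sum u == g) && (weight M u == w)) (exponents n d).
  by exists (weight M v); apply/hasP; exists v; rewrite ?vE ?eqxx.
case: (ex_minnP exw) => w /hasP[u Vu /andP[/eqP uE /eqP wE]] minw.
exists u => //; move: Vu; rewrite mem_exponents => /andP[/eqP su /eqP du].
apply/mem_minimal_exponents; split=> // t st dt tE; rewrite wE; apply: minw.
by apply/hasP; exists t; rewrite ?mem_exponents ?st ?dt ?tE ?uE ?eqxx.
Qed.

(** Incrementing entry [i] shifts sum and weight by amounts depending only on [i], so a lighter
    rival of [u] would yield one of [incr_nth u i]. *)
Lemma minimal_exponents_shadow M d u i : (i < size u)%N ->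
  incr_nth u i \in minimal_exponents M d.+1 -> u \in minimal_exponents M d.
Proof.
move=> iu /mem_minimal_exponents[]; rewrite size_incr_nth iu sumn_incr_nth//.
move=> [su [du]] minu; apply/mem_minimal_exponents; split=> // t st dt tu.
have it : (i < size t)%N by rewrite st -su.
have := minu (incr_nth t i); rewrite size_incr_nth it sumn_incr_nth// st dt.
rewrite !weight_incr_nth// leq_add2r; apply=> //.
by rewrite !monomial_sum_incr_nth -?su// tu.
Qed.

End MinimalRepresentations.

(** * Reduction of the claim to the shadow bound *)

Lemma theta_gbinom (R : realType) (x : R) h : h.+1%:R <= x ->
  theta x h.+1 * gbinom x h.+1 `^ ((h.+1%:R - 1) / h.+1%:R) = gbinom (x - 1) h.
Proof.
move=> hx; have b0 : 0 < gbinom x h.+1 by apply: gbinom_gt0; lra.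
have h0 : 0 < h.+1%:R :> R by rewrite ltr0n.
(* The exponents of [gbinom x h.+1] add up to 1, and [h.+1 / x] cancels the factor from
   [gbinomS_shift]. *)
rewrite /theta -[LHS]mulrA -powRD; last by rewrite (gt_eqF b0) implybT.
rewrite -mulrDl addrC subrK divff ?gt_eqF// powRr1 ?ltW// gbinomS_shift.
by field; rewrite !gt_eqF//; lra.
Qed.

Local Open Scope fset_scope.

Theorem theorem4p9 (R : realType) (G : zmodType) (A : {fset G}) (h : nat)
    (x : R) (A_neq0 : A != fset0) (h_ge2 : (2 <= h)%N) (hx : h%:R <= x)
    (card_hA : (#|` sumset h A|)%:R = gbinom x h) :
  theta x h * (#|` sumset h A|)%:R `^ ((h%:R - 1) / h%:R)
    <= (#|` sumset (h - 1) A|)%:R.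
Proof.
case: h h_ge2 hx card_hA => [|h] // _ hx card_hA.
(* One base must serve both degrees [h] and [h.+1]; [h.+2] exceeds both. *)
rewrite card_hA theta_gbinom// subn1 /= -(@size_minimal_exponents _ _ h.+2)//.
apply: (@shadow_bound _ #|` A| _ (minimal_exponents A h.+2 h.+1) _ x _ _ _ _ hx).
- exact/filter_uniq/undup_uniq.
- exact/filter_uniq/undup_uniq.
- by move=> v /mem_minimal_exponents[].
- exact: minimal_exponents_shadow.
- by rewrite size_minimal_exponents.
Qed.
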